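(* Let $A$ be any bicommutative superalgebra over a field of characteristic different from $2$. Then its square $A^2$ is an associative super-commutative superalgebra, i.e. for all homogeneous $a,b,c\in A^2$ one has $(ab)c=a(bc)$ and $ba=(-1)^{\overline a\,\overline b}ab$.
   Context: Algebras are not assumed associative or unital. A superalgebra is an algebra $A=A_0\oplus A_1$ with $A_iA_j\subseteq A_{i+j\,(\mathrm{mod}\,2)}$; for $a\in A_i$ write $\overline a=i$. A superalgebra is bicommutative if for all homogeneous elements $x_1(x_2x_3)=(-1)^{\overline{x_1}\,\overline{x_2}}x_2(x_1x_3)$ and $(x_1x_2)x_3=(-1)^{\overline{x_2}\,\overline{x_3}}(x_1x_3)x_2$. $A^2$ denotes the linear span of all products $ab$, $a,b\in A$. *)

(* Defs.v *)
From HB Require Import structures.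
From mathcomp Require Import all_boot all_order all_algebra.
From mathcomp Require Import classical_sets.

Set Implicit Arguments.
Unset Strict Implicit.
Unset Printing Implicit Defensive.

Import GRing.Theory.

Local Open Scope classical_set_scope.
Local Open Scope ring_scope.

(* An algebra over F, with no associativity or unit required, is an F-module A
   with a bilinear map mul : A -> A -> A. Degrees are booleans: false is 0, true
   is 1, (+) is addition mod 2, and i, j : bool are cast to nat in signs
   (-1) ^+ (i * j). *)

Definition subspace (F : fieldType) (A : lmodType F) (B : set A) : Prop :=
  B 0 /\ forall (c : F) (x y : A), B x -> B y -> B (c *: x + y).

Definition direct_sum (F : fieldType) (A : lmodType F) (B B0 B1 : set A) : Prop :=
  B = [set x | exists x0 x1, [/\ B0 x0, B1 x1 & x = x0 + x1]] /\
  B0 `&` B1 = [set 0].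

(* The subset B of A, with graded parts B_ i, is a superalgebra for the product
   of A. For A itself, take B := setT. *)
Definition is_superalgebra (F : fieldType) (A : lmodType F)
    (mul : {bilinear A -> A -> A}) (B : set A) (B_ : bool -> set A) : Prop :=
  [/\ subspace B,
      forall i, subspace (B_ i),
      direct_sum B (B_ false) (B_ true) &
      forall i j x y, B_ i x -> B_ j y -> B_ (i (+) j) (mul x y)].

Definition is_bicommutative (F : fieldType) (A : lmodType F)
    (mul : {bilinear A -> A -> A}) (B_ : bool -> set A) : Prop :=
  forall i1 i2 i3 x1 x2 x3, B_ i1 x1 -> B_ i2 x2 -> B_ i3 x3 ->
    mul x1 (mul x2 x3) = (-1) ^+ (i1 * i2)%N *: mul x2 (mul x1 x3) /\
    mul (mul x1 x2) x3 = (-1) ^+ (i2 * i3)%N *: mul (mul x1 x3) x2.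

Definition is_associative (F : fieldType) (A : lmodType F)
    (mul : {bilinear A -> A -> A}) (B_ : bool -> set A) : Prop :=
  forall i j k a b c, B_ i a -> B_ j b -> B_ k c ->
    mul (mul a b) c = mul a (mul b c).

Definition is_super_commutative (F : fieldType) (A : lmodType F)
    (mul : {bilinear A -> A -> A}) (B_ : bool -> set A) : Prop :=
  forall i j a b, B_ i a -> B_ j b ->
    mul b a = (-1) ^+ (i * j)%N *: mul a b.

Definition alg_square (F : fieldType) (A : lmodType F)
    (mul : {bilinear A -> A -> A}) : set A :=
  [set x | exists (n : nat) (c : 'I_n -> F) (a b : 'I_n -> A),
             x = \sum_(i < n) c i *: mul (a i) (b i)].

(* Main.v *)
Require Import Defs.
From HB Require Import structures.
From mathcomp Require Import all_boot all_order all_algebra.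
From mathcomp Require Import classical_sets.

(** Up to signs, a product [(a b) (c d)] of two products can be rearranged in two
    ways.  The left law carries [c] to the front and back, and the right law
    exchanges [b] and [d] in between:
    [(a b) (c d) = c ((a b) d) = c ((a d) b) = (a d) (c b)].  Symmetrically, the
    right law moves [b], and the left law exchanges [a] and [c]:
    [(a b) (c d) = (a (c d)) b = (c (a d)) b = (c b) (a d)].  The results are
    the products of [a d] and [c b] in both orders, so these super-commute
    ([mul_prod_supercomm]).

    A homogeneous element of the square of [A] is a sum of products of
    homogeneous elements with the same total degree ([homogeneous_square_ind]),
    so super-commutativity extends to the whole square by bilinearity.
    Associativity follows from it and left bicommutativity:
    [(a b) c = c (a b) = a (c b) = a (b c)] up to signs, and the signs cancel. *)

Set Implicit Arguments.
Unset Strict Implicit.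
Unset Printing Implicit Defensive.

Import GRing.Theory.

Local Open Scope classical_set_scope.
Local Open Scope ring_scope.

Section Square.

Variables (F : fieldType) (A : lmodType F) (mul : {bilinear A -> A -> A}).

Lemma mulDl x y z : mul (x + y) z = mul x z + mul y z.
Proof. exact: linearDl. Qed.

Lemma mulDr x y z : mul x (y + z) = mul x y + mul x z.
Proof. exact: linearDr. Qed.

Lemma mulZl c x y : mul (c *: x) y = c *: mul x y.
Proof. exact: linearZl_LR. Qed.

Lemma mulZr c x y : mul x (c *: y) = c *: mul x y.
Proof. exact: linearZr_LR. Qed.

Lemma subspaceD (B : set A) x y : subspace B -> B x -> B y -> B (x + y).
Proof. by move=> [_ BL] Bx By; rewrite -[x]scale1r; exact: BL. Qed.

Lemma subspaceZ (B : set A) c x : subspace B -> B x -> B (c *: x).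
Proof. by move=> [B0 BL] Bx; rewrite -[_ *: _]addr0; exact: BL. Qed.

Lemma subspaceB (B : set A) x y : subspace B -> B x -> B y -> B (x - y).
Proof.
by move=> sB Bx By; rewrite -scaleN1r; apply: subspaceD => //; exact: subspaceZ.
Qed.

Lemma subspace_setI (B C : set A) :
  subspace B -> subspace C -> subspace (B `&` C).
Proof.
move=> [B0 BL] [C0 CL]; split=> [|c x y [Bx Cx] [By Cy]]; first by split.
by split; [exact: BL | exact: CL].
Qed.

Lemma subspace_sum (B C : set A) : subspace B -> subspace C ->
  subspace [set x | exists y z, [/\ B y, C z & x = y + z]].
Proof.
move=> [B0 BL] [C0 CL]; split=> [|c x x'].
  by exists 0, 0; split; rewrite ?addr0.
move=> [y [z [By Cz ->]]] [y' [z' [By' Cz' ->]]].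
exists (c *: y + y'), (c *: z + z'); split; [exact: BL | exact: CL |].
by rewrite scalerDr addrACA.
Qed.

Lemma subspace_alg_square : subspace (alg_square mul).
Proof.
split; first by exists 0, (fun=> 0), (fun=> 0), (fun=> 0); rewrite big_ord0.
move=> k x y [n [c [a [b ->]]]] [m [c' [a' [b' ->]]]].
exists (n + m)%N.
exists (fun i => match split i with inl j => k * c j | inr j => c' j end).
exists (fun i => match split i with inl j => a j | inr j => a' j end).
exists (fun i => match split i with inl j => b j | inr j => b' j end).
rewrite big_split_ord scaler_sumr; congr (_ + _); apply: eq_bigr => i _.
  by have -> : split (lshift m i) = inl i := unsplitK (inl i); rewrite scalerA.
by have -> : split (rshift n i) = inr i := unsplitK (inr i).
Qed.

Lemma alg_square_mul x y : alg_square mul (mul x y).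
Proof.
exists 1%N, (fun=> 1), (fun=> x), (fun=> y).
by rewrite big_ord_recl big_ord0 addr0 scale1r.
Qed.

Lemma alg_square_min (B : set A) :
  subspace B -> (forall x y, B (mul x y)) -> alg_square mul `<=` B.
Proof.
move=> sB BM _ [n [c [a [b ->]]]].
elim/big_ind: _ => [|x y Bx By|i _]; first by case: sB.
- exact: subspaceD.
- exact: subspaceZ.
Qed.

Section Graded.

Variable A_ : bool -> set A.
Hypothesis sA : is_superalgebra mul setT A_.

Lemma subspace_part i : subspace (A_ i).
Proof. by case: sA. Qed.

Lemma mul_part i j x y : A_ i x -> A_ j y -> A_ (i (+) j) (mul x y).
Proof. by case: sA => _ _ _; apply. Qed.

Lemma decompose x : exists x0 x1, [/\ A_ false x0, A_ true x1 & x = x0 + x1].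
Proof.
by case: sA => _ _ [dA _] _; have : setT x by []; rewrite dA.
Qed.

Lemma parts_disjoint x : A_ false x -> A_ true x -> x = 0.
Proof.
case: sA => _ _ [_ iA] _ x0 x1.
by have : (A_ false `&` A_ true) x by []; rewrite iA.
Qed.

(** The elements of [A] whose two components lie in [Q false] and [Q true] form
    a subspace.  It contains all products: expand both factors into homogeneous
    components and group the four terms by degree. *)
Lemma square_decompose (Q : bool -> set A) :
  (forall i, subspace (Q i)) ->
  (forall i j a b, A_ i a -> A_ j b -> Q (i (+) j) (mul a b)) ->
  forall x, alg_square mul x -> exists x0 x1,
    [/\ (A_ false `&` Q false) x0, (A_ true `&` Q true) x1 & x = x0 + x1].
Proof.
move=> sQ QM.
have sAQ i : subspace (A_ i `&` Q i).
  by apply: subspace_setI => //; exact: subspace_part.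
have AQM i j a b : A_ i a -> A_ j b -> (A_ (i (+) j) `&` Q (i (+) j)) (mul a b).
  by move=> Aa Ab; split; [exact: mul_part | exact: QM].
apply: alg_square_min => [|x y]; first exact: subspace_sum.
have [x0 [x1 [Ax0 Ax1 ->]]] := decompose x.
have [y0 [y1 [Ay0 Ay1 ->]]] := decompose y.
exists (mul x0 y0 + mul x1 y1), (mul x0 y1 + mul x1 y0); split.
- by apply: subspaceD => //; [exact: (AQM false false) | exact: (AQM true true)].
- by apply: subspaceD => //; [exact: (AQM false true) | exact: (AQM true false)].
by rewrite mulDl !mulDr [mul x1 y0 + _]addrC addrACA.
Qed.

(** The components given by [square_decompose] are the only ones, so for a
    homogeneous element the component of the other degree vanishes. *)
Lemma homogeneous_square_ind (Q : bool -> set A) :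
  (forall i, subspace (Q i)) ->
  (forall i j a b, A_ i a -> A_ j b -> Q (i (+) j) (mul a b)) ->
  forall i x, (alg_square mul `&` A_ i) x -> Q i x.
Proof.
move=> sQ QM i x [A2x Ax].
have [x0 [x1 [[Ax0 Qx0] [Ax1 Qx1] xE]]] := square_decompose sQ QM A2x.
case: i Ax => Ax.
- have x00 : x0 = 0.
    apply: parts_disjoint => //; rewrite -[x0](addrK x1) -xE.
    exact: (subspaceB (subspace_part true)).
  by rewrite xE x00 add0r.
- have x10 : x1 = 0.
    apply: parts_disjoint => //; rewrite -[x1](addKr x0) -xE addrC.
    exact: (subspaceB (subspace_part false)).
  by rewrite xE x10 addr0.
Qed.

Lemma alg_square_superalgebra :
  is_superalgebra mul (alg_square mul) (fun i => alg_square mul `&` A_ i).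
Proof.
have s2 := subspace_alg_square.
split=> // [i||i j x y [_ Ax] [_ Ay]].
- by apply: subspace_setI => //; exact: subspace_part.
- split; apply/seteqP; split=> x.
  + move=> A2x.
    have [x0 [x1 [[? ?] [? ?] xE]]] :=
      square_decompose (fun=> s2) (fun _ _ a b _ _ => alg_square_mul a b) A2x.
    by exists x0, x1.
  + by move=> [x0 [x1 [[? _] [? _] ->]]]; exact: subspaceD.
  + by move=> [[_ Ax0] [_ Ax1]]; exact: parts_disjoint.
  + move=> ->; case: (s2) => z2 _.
    by split; split=> //; case: (subspace_part true); case: (subspace_part false).
- by split; [exact: alg_square_mul | exact: mul_part].
Qed.

Hypothesis bA : is_bicommutative mul A_.

Lemma bicommL i j k x y z : A_ i x -> A_ j y -> A_ k z ->
  mul x (mul y z) = (-1) ^+ (i * j)%N *: mul y (mul x z).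
Proof. by move=> Ax Ay Az; case: (bA Ax Ay Az). Qed.

Lemma bicommR i j k x y z : A_ i x -> A_ j y -> A_ k z ->
  mul (mul x y) z = (-1) ^+ (j * k)%N *: mul (mul x z) y.
Proof. by move=> Ax Ay Az; case: (bA Ax Ay Az). Qed.

Lemma eq_sign (m n : nat) : odd m = odd n -> (-1) ^+ m = (-1) ^+ n :> F.
Proof. by move=> mn; rewrite -signr_odd mn signr_odd. Qed.

Lemma signZK (n : nat) (x : A) : (-1) ^+ n *: ((-1) ^+ n *: x) = x.
Proof.
by rewrite scalerA -exprD (@eq_sign _ 0) ?scale1r // oddD addbb.
Qed.

(** Both sides arise from [(a b) (c d)]: the left law and an exchange of [b] and
    [d] lead to [(a d) (c b)], the right law and an exchange of [a] and [c] to
    [(c b) (a d)]. *)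
Lemma mul_prod_supercomm i j k l a b c d :
  A_ i a -> A_ j b -> A_ k c -> A_ l d ->
  mul (mul c b) (mul a d) =
    (-1) ^+ ((i (+) l) * (k (+) j))%N *: mul (mul a d) (mul c b).
Proof.
move=> Aa Ab Ac Ad.
have Aab := mul_part Aa Ab; have Aad := mul_part Aa Ad.
have Acd := mul_part Ac Ad.
have viaL : mul (mul a b) (mul c d) =
    (-1) ^+ ((i (+) j) * k + j * l + k * (i (+) l))%N *:
      mul (mul a d) (mul c b).
  rewrite (bicommL Aab Ac Ad) (bicommR Aa Ab Ad) mulZr.
  by rewrite (bicommL Ac Aad Ab) !scalerA -!exprD.
have viaR : mul (mul a b) (mul c d) =
    (-1) ^+ (j * (k (+) l) + i * k + (i (+) l) * j)%N *:
      mul (mul c b) (mul a d).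
  rewrite (bicommR Aa Ab Acd) (bicommL Aa Ac Ad) mulZl.
  by rewrite (bicommR Ac Aad Ab) !scalerA -!exprD.
rewrite -[LHS](signZK (j * (k (+) l) + i * k + (i (+) l) * j)) -viaR viaL.
rewrite scalerA -exprD; congr (_ *: _); apply: eq_sign.
by move: (i) (j) (k) (l) => [] [] [] [].
Qed.

Lemma subspace_supercomm (y : A) (s : F) :
  subspace [set x | mul y x = s *: mul x y].
Proof.
split=> [|c x z /= ex ez]; first by rewrite /= linear0r linear0l scaler0.
by rewrite mulDr mulZr ex ez mulDl mulZl scalerDr !scalerA mulrC.
Qed.

Lemma alg_square_supercomm :
  is_super_commutative mul (fun i => alg_square mul `&` A_ i).
Proof.
move=> i j a b A2a A2b.
(* First [b] is reduced to a product, then [a]: the relation is linear in each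
   factor, and multiplying by the sign turns it around. *)
suff H : forall j b, (alg_square mul `&` A_ j) b ->
    mul a b = (-1) ^+ (j * i)%N *: mul b a.
  by rewrite (H j b A2b) mulnC signZK.
apply: (homogeneous_square_ind (Q := fun j : bool =>
  [set y | mul a y = (-1) ^+ (j * i)%N *: mul y a])) => [k|k l c d Ac Ad /=].
  exact: subspace_supercomm.
suff H : forall i a, (alg_square mul `&` A_ i) a ->
    mul (mul c d) a = (-1) ^+ (i * (k (+) l))%N *: mul a (mul c d).
  by rewrite (H i a A2a) mulnC signZK.
apply: (homogeneous_square_ind (Q := fun i : bool => [set x |
  mul (mul c d) x = (-1) ^+ (i * (k (+) l))%N *: mul x (mul c d)])).
  by move=> m; exact: subspace_supercomm.
by move=> m n e f Ae Af; exact: mul_prod_supercomm.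
Qed.

Lemma alg_square_assoc : is_associative mul (fun i => alg_square mul `&` A_ i).
Proof.
move=> i j k a b c [A2a Aa] A2b A2c; have [_ Ab] := A2b; have [_ Ac] := A2c.
have A2ab : (alg_square mul `&` A_ (i (+) j)) (mul a b).
  by split; [exact: alg_square_mul | exact: mul_part].
rewrite (alg_square_supercomm A2c A2ab) (bicommL Ac Aa Ab).
rewrite (alg_square_supercomm A2b A2c) mulZr !scalerA -!exprD.
rewrite (@eq_sign _ 0) ?scale1r //.
by move: (i) (j) (k) => [] [] [].
Qed.

End Graded.

End Square.

Theorem mainTheorem2 (F : fieldType) (A : lmodType F)
    (mul : {bilinear A -> A -> A}) (A_ : bool -> set A) :
  2%N \notin [pchar F] ->
  is_superalgebra mul setT A_ ->
  is_bicommutative mul A_ ->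
  let A2 := alg_square mul in
  let A2_ := fun i => A2 `&` A_ i in
  [/\ is_superalgebra mul A2 A2_,
      is_associative mul A2_ &
      is_super_commutative mul A2_].
Proof.
move=> _ sA bA A2 A2_; split.
- exact: alg_square_superalgebra.
- exact: alg_square_assoc.
- exact: alg_square_supercomm.
Qed.
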